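(* Let $k,m$ be integers with $0<k<m$, let $h>0$ be the mesh size, and let $X^{(k)}(h)=\|u_h^{(k)}-u\|_{1,\Omega}$ and $X^{(m)}(h)=\|u_h^{(m)}-u\|_{1,\Omega}$ be the approximation errors of the $P_k$ and $P_m$ Lagrange finite elements, regarded as random variables, with $0\le X^{(i)}(h)\le C_i h^i$ and $X^{(i)}(h)$ uniformly distributed on $[0,C_i h^i]$ for $i=k$ and $i=m$. Let $h^*=\left(C_k/C_m\right)^{1/(m-k)}$, and let $A$ and $B$ be the two events $$A=\left\{\|u_h^{(m)}-u\|_{1,\Omega}\le\|u_h^{(k)}-u\|_{1,\Omega}\right\},\qquad B=\left\{\|u_h^{(k)}-u\|_{1,\Omega}\in[C_m h^m,\,C_k h^k]\right\}.$$ Assume that $A$ and $B$ are independent. Then the probability distribution of the event $\left\{X^{(m)}(h)\le X^{(k)}(h)\right\}$ is given by $$\mathrm{Prob}\left\{X^{(m)}(h)\le X^{(k)}(h)\right\}=\begin{cases}1 & \text{if } 0<h<h^*,\\ 0 & \text{if } h>h^*.\end{cases}$$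
   Context: Let $\Omega\subset\mathbb{R}^n$ be open, bounded and non-empty with piecewise $C^1$ boundary. Let $V$ be a Hilbert space which is a usual Sobolev space of distributions, $a$ a bilinear continuous $V$-elliptic form on $V\times V$, and $l$ a continuous linear form on $V$. Let $u\in V$ be the unique solution of the second order elliptic variational problem $a(u,v)=l(v)$ for all $v\in V$, and assume $u\in H^{m+1}(\Omega)$. For $i\in\{k,m\}$, $u_h^{(i)}$ denotes the $P_i$ Lagrange finite element approximation of $u$: the solution in $V_h^{(i)}$ of $a(u_h^{(i)},v_h)=l(v_h)$ for all $v_h\in V_h^{(i)}$, where $V_h^{(i)}\subset V$ is the finite-dimensional space of continuous functions that are polynomials of degree at most $i$ on each $n$-simplex of a mesh exactly covering $\Omega$, respecting the classical rules of regular discretization and of maximal diameter $h$. For the given value of $h$, two independent meshes, built by a mesh generator, are considered for $P_k$ and $P_m$. The meshes are regarded as random: a random trial is the constitution of the grid and of the associated approximation, and the probability space consists of all grids the mesh generator may produce (equivalently, of all associated approximations). The norm $\|\cdot\|_{1,\Omega}$ is the classical norm of $H^1(\Omega)$. The error estimate that follows from the Bramble-Hilbert lemma gives $\|u_h^{(i)}-u\|_{1,\Omega}\le C_i h^i$ with $C_i=\mathscr{C}_i\,|u|_{i+1,\Omega}$, where $\mathscr{C}_i>0$ is a constant independent of $h$ and $|\cdot|_{i+1,\Omega}$ is the semi-norm of $H^{i+1}(\Omega)$; $C_k$ and $C_m$ are taken to be positive, so that $h^*$ is defined and positive.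
   Formalization: For h > h* the interval [C_m h^m, C_k h^k] is empty, so independence of A and B says nothing and the value 0 can fail; the formal statement additionally assumes, for h > h* only, that A is independent of B' = {‖u_h^(m) − u‖ ∈ [C_k h^k, C_m h^m]}. *)

(* Defs.v *)
From HB Require Import structures.
From mathcomp Require Import all_boot all_order all_algebra.
From mathcomp Require Import all_classical all_reals all_analysis.

Set Implicit Arguments.
Unset Strict Implicit.
Unset Printing Implicit Defensive.

Import Order.TTheory GRing.Theory Num.Theory.
Import numFieldNormedType.Exports.

Local Open Scope classical_set_scope.
Local Open Scope ring_scope.

(* R^n with its Borel sigma-algebra; convertible to 'rV[R]_n. *)
Notation borel_rV R n := (g_sigma_algebraType (@open 'rV[R]_n)).

Section LebesgueMeasure.
Context (R : realType).

(* n-dimensional Lebesgue measure of Borel sets, by slicing along the first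
   coordinate (Tonelli). *)
Fixpoint lebesgue_rV (n : nat) : set 'rV[R]_n -> \bar R :=
  match n with
  | 0 => fun A => (\1_A 0)%:E
  | n'.+1 => fun A =>
      (\int[@lebesgue_measure R]_x
         @lebesgue_rV n' [set y : 'rV[R]_n' | A (row_mx (x%:M : 'M[R]_1) y)])%E
  end.

End LebesgueMeasure.

Section SobolevSpaces.
Context (R : realType) (n : nat).
Implicit Types (Omega : set 'rV[R]_n) (f g phi : 'rV[R]_n -> R).
Implicit Types (alpha : 'I_n -> nat).

Definition int_on Omega f : \bar R :=
  (\int[@lebesgue_rV R n : set (borel_rV R n) -> \bar R]_(x in Omega)
     (f x)%:E)%E.

Definition partial (i : 'I_n) f : 'rV[R]_n -> R :=
  fun x => 'D_(delta_mx 0 i) f x.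

Definition partials (w : seq 'I_n) f : 'rV[R]_n -> R := foldr partial f w.

Definition mlen alpha : nat := (\sum_(i < n) alpha i)%N.

Definition mpartial alpha f : 'rV[R]_n -> R :=
  partials (flatten [seq nseq (alpha i) i | i <- enum 'I_n]) f.

Definition test_function Omega phi : Prop :=
  (forall (w : seq 'I_n) (x : 'rV[R]_n), differentiable (partials w phi) x) /\
  exists K : set 'rV[R]_n,
    [/\ compact K, K `<=` Omega & forall x, ~ K x -> phi x = 0].

(* Elements of L^2 and of the Sobolev spaces are represented by Borel
   functions on R^n, of which only the restriction to Omega matters. *)
Definition L2 Omega f : Prop :=
  measurable_fun (Omega : set (borel_rV R n)) (f : borel_rV R n -> R) /\
  (int_on Omega (fun x => (f x ^+ 2)%R) < +oo)%E.

Definition is_weak_deriv Omega alpha f g : Prop :=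
  L2 Omega g /\
  forall phi, test_function Omega phi ->
    int_on Omega (fun x => f x * mpartial alpha phi x) =
    (((-1) ^+ mlen alpha)%:E * int_on Omega (fun x => (g x * phi x)%R))%E.

Definition sobolev (s : nat) Omega : set ('rV[R]_n -> R) :=
  [set f | L2 Omega f /\
    forall alpha, (mlen alpha <= s)%N -> exists g, is_weak_deriv Omega alpha f g].

(* A representative of the weak derivative, which is unique up to a
   Lebesgue-null subset of Omega; it is 0 when there is no weak derivative. *)
Definition weak_deriv Omega alpha f : 'rV[R]_n -> R :=
  xget (fun=> 0) [set g | is_weak_deriv Omega alpha f g].

Definition sobolev_seminorm (s : nat) Omega f : R :=
  Num.sqrt (\sum_(alpha : {ffun 'I_n -> 'I_s.+1} | mlen (fun i => alpha i) == s)
    fine (int_on Omega (fun x => weak_deriv Omega (fun i => alpha i) f x ^+ 2))).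

Definition H1_norm Omega f : R :=
  Num.sqrt (sobolev_seminorm 0 Omega f ^+ 2 + sobolev_seminorm 1 Omega f ^+ 2).

(* For a second order problem the usual spaces V are the closed subspaces of
   H^1(Omega) containing the test functions: H^1, H^1_0, and the spaces
   encoding a Dirichlet condition on a part of the boundary.  They are Hilbert
   spaces for the H^1 inner product. *)
Record usual_sobolev_space Omega (V : set ('rV[R]_n -> R)) : Prop := {
  uss_sub : V `<=` sobolev 1 Omega;
  uss_test : forall phi, test_function Omega phi -> V phi;
  uss_lin : forall (c : R) v w, V v -> V w -> V (c *: v + w);
  uss_closed : forall (v_ : nat -> 'rV[R]_n -> R) v,
    (forall j, V (v_ j)) -> sobolev 1 Omega v ->
    H1_norm Omega (v_ j - v) @[j --> \oo] --> 0 -> V v }.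

End SobolevSpaces.

Section Domain.
Context (R : realType) (n : nat).

(* The boundary is a finite union of C^1 patches: injective immersions of the
   closed unit cube of R^(n-1). *)
Definition piecewise_C1_boundary (Omega : set 'rV[R]_n) : Prop :=
  exists (N : nat) (gam : 'I_N -> 'rV[R]_n.-1 -> 'rV[R]_n),
    let cube := [set p : 'rV[R]_n.-1 | forall i, 0 <= p 0 i <= 1] in
    (forall j : 'I_N,
      [/\ forall p, differentiable (gam j) p,
          continuous (jacobian (gam j)),
          {in cube &, injective (gam j)} &
          forall p, cube p -> \rank (jacobian (gam j) p) = n.-1]) /\
    closure Omega `\` interior Omega = \bigcup_j (gam j @` cube).

End Domain.

Section VariationalProblem.
Context (R : realType) (n : nat).
Variables (Omega : set 'rV[R]_n) (V : set ('rV[R]_n -> R)).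

Record elliptic_form (a : ('rV[R]_n -> R) -> ('rV[R]_n -> R) -> R) : Prop := {
  ef_linl : forall (c : R) v1 v2 w, V v1 -> V v2 -> V w ->
    a (c *: v1 + v2) w = c * a v1 w + a v2 w;
  ef_linr : forall (c : R) v w1 w2, V v -> V w1 -> V w2 ->
    a v (c *: w1 + w2) = c * a v w1 + a v w2;
  ef_cont : exists M : R, forall v w, V v -> V w ->
    `|a v w| <= M * H1_norm Omega v * H1_norm Omega w;
  ef_coercive : exists2 c : R, 0 < c &
    forall v, V v -> c * H1_norm Omega v ^+ 2 <= a v v }.

Record continuous_linear_form (l : ('rV[R]_n -> R) -> R) : Prop := {
  clf_lin : forall (c : R) v w, V v -> V w -> l (c *: v + w) = c * l v + l w;
  clf_cont : exists M : R, forall v, V v -> `|l v| <= M * H1_norm Omega v }.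

Definition variational_solution (a : ('rV[R]_n -> R) -> ('rV[R]_n -> R) -> R)
    (l : ('rV[R]_n -> R) -> R) (W : set ('rV[R]_n -> R)) u : Prop :=
  W u /\ forall v, W v -> a u v = l v.

End VariationalProblem.

Section FiniteElements.
Context (R : realType) (n : nat).

(* An n-simplex is given by the matrix whose n + 1 rows are its vertices. *)
Implicit Types (K L : 'M[R]_(n.+1, n)) (T : seq 'M[R]_(n.+1, n)).

Definition face K (I : {set 'I_n.+1}) : set 'rV[R]_n :=
  [set t *m K | t in [set t : 'rV[R]_n.+1 |
    [/\ forall i, 0 <= t 0 i, forall i, i \notin I -> t 0 i = 0 &
        \sum_i t 0 i = 1]]].

Definition simplex K : set 'rV[R]_n := face K [set: 'I_n.+1]%SET.

(* affine independence of the vertices *)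
Definition nondegenerate K : Prop :=
  \rank (row_mx K (const_mx 1 : 'cV[R]_n.+1)) = n.+1.

Definition eucl_dist (x y : 'rV[R]_n) : R :=
  Num.sqrt (\sum_i (x 0 i - y 0 i) ^+ 2).

Definition diameter (A : set 'rV[R]_n) : R :=
  sup [set eucl_dist x.1 x.2 | x in A `*` A].

Definition inner_diameter (A : set 'rV[R]_n) : R :=
  sup [set 2 * r | r in [set r : R | 0 <= r /\
    exists c, [set y | eucl_dist c y <= r] `<=` A]].

(* A conforming simplicial mesh covering Omega exactly, of maximal diameter h,
   with regularity constant sigma.  Properness of I makes the interiors of
   distinct elements disjoint; I = set0 is the case of disjoint elements. *)
Record regular_mesh (Omega : set 'rV[R]_n) (sigma h : R) T : Prop := {
  rm_uniq : uniq T;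
  rm_nondeg : forall K, K \in T -> nondegenerate K;
  rm_cover : closure Omega = [set x | exists2 K, K \in T & simplex K x];
  rm_conform : forall K L, K \in T -> L \in T -> K != L ->
    exists I J : {set 'I_n.+1}, [/\ I \proper [set: 'I_n.+1]%SET,
      simplex K `&` simplex L = face K I & face K I = face L J];
  rm_regular : forall K, K \in T ->
    diameter (simplex K) <= sigma * inner_diameter (simplex K);
  rm_diam_le : forall K, K \in T -> diameter (simplex K) <= h;
  rm_diam_max : exists2 K, K \in T & diameter (simplex K) = h }.

Definition polynomial_on (i : nat) (A : set 'rV[R]_n) (v : 'rV[R]_n -> R) : Prop :=
  exists c : {ffun 'I_n -> 'I_i.+1} -> R, forall x, A x ->
    v x = \sum_(alpha : {ffun 'I_n -> 'I_i.+1} | (mlen (fun j => alpha j) <= i)%N)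
            c alpha * \prod_j x 0 j ^+ alpha j.

Definition Lagrange_space (Omega : set 'rV[R]_n) (V : set ('rV[R]_n -> R))
    (i : nat) T : set ('rV[R]_n -> R) :=
  [set v | [/\ V v, {within closure Omega, continuous v} &
               forall K, K \in T -> polynomial_on i (simplex K) v]].

End FiniteElements.

Section Probability.
Context d (S : measurableType d) (R : realType) (P : probability S R).

Definition uniform_on (X : {RV P >-> R}) (a b : R) : Prop :=
  exists ab : a < b, forall A : set R, measurable A ->
    distribution P X A = uniform_prob ab A.

Definition independent_events (A B : set S) : Prop :=
  (P (A `&` B) = P A * P B)%E.

End Probability.

(* Main.v *)
Require Import Defs.
From HB Require Import structures.
From mathcomp Require Import all_boot all_order all_algebra.
From mathcomp Require Import all_classical all_reals all_analysis.
Import Order.TTheory GRing.Theory Num.Theory.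
Import numFieldNormedType.Exports.
Local Open Scope classical_set_scope.
Local Open Scope ring_scope.

(** The event [A] that the [P_m] error is at most the [P_k] error is assumed
    independent of an event of positive probability which, for deterministic
    reasons, either implies [A] or almost surely excludes it.  Independence
    then leaves [A] no probability but 1, respectively 0.

    Write [bk = Ck * h ^+ k] and [bm = Cm * h ^+ m] for the two error bounds.
    Since [hstar ^+ (m - k) = Ck / Cm], the condition [h < hstar] says exactly
    that [bm < bk] ([ltr_crossover]), and [hstar < h] that [bk < bm]
    ([gtr_crossover]).

    If [bm < bk], an outcome with [Xk] in [[bm, bk]] has [Xm <= bm <= Xk], so
    [B] is contained in [A].  Independence turns this into
    [P B = P A * P B], and [P B > 0] because [Xk] is uniform and [[bm, bk]]
    is a nondegenerate subinterval of its range: hence [P A = 1].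

    If [bk < bm], an outcome in [A] with [Xm] in [[bk, bm]] has
    [bk <= Xm <= Xk <= bk], so [Xm] takes the single value [bk], which has
    probability zero.  Independence now gives [P A * P B' = 0] with
    [P B' > 0]: hence [P A = 0]. *)

Set Implicit Arguments.
Unset Strict Implicit.

Section IndependentEvents.
Context d (S : measurableType d) (R : realType) (P : probability S R).
Implicit Types A B : set S.

(** Here [P B = P (A `&` B) = P A * P B], and [P B] can be cancelled. *)
Lemma independent_sub_eq1 A B : measurable A -> measurable B ->
  independent_events P A B -> B `<=` A -> (0 < P B)%E -> P A = 1%E.
Proof.
move=> mA mB iAB BA PB0; move: iAB.
rewrite /independent_events setIidr// -(fineK (fin_num_measure P A mA)).
have PBfin := fin_num_measure P B mB.
rewrite -(fineK PBfin) -EFinM => -[] PAB.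
have PB_neq0 : fine (P B) != 0 by rewrite gt_eqF// fine_gt0// PB0 ltey_eq PBfin.
by congr EFin; apply: (mulIf PB_neq0); rewrite mul1r.
Qed.

Lemma independent_setI_eq0 A B : independent_events P A B ->
  P (A `&` B) = 0%E -> (0 < P B)%E -> P A = 0%E.
Proof.
rewrite /independent_events => -> /eqP.
by rewrite mule_eq0 => /orP[/eqP//|/eqP ->]; rewrite ltxx.
Qed.

End IndependentEvents.

Section UniformErrors.
Context d (S : measurableType d) (R : realType) (P : probability S R).
Implicit Types X Y : {RV P >-> R}.

Lemma measurable_preimage_itv X (c e : R) : measurable (X @^-1` `[c, e]).
Proof. by rewrite -[_ @^-1` _]setTI; exact: measurable_funPT. Qed.

Lemma uniform_on_itv X (a b c e : R) : uniform_on X a b ->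
  a <= c -> c <= e -> e <= b ->
  P (X @^-1` `[c, e]) = ((e - c) / (b - a))%:E.
Proof.
move=> [ab /(_ `[c, e]%classic (measurable_itv _))] + ac ce eb.
rewrite /distribution /pushforward => ->.
rewrite /uniform_prob (eq_integral (fun=> (b - a)^-1%:E)); last first.
  move=> x; rewrite inE/= in_itv/= => /andP[cx xe].
  by rewrite /uniform_pdf (le_trans ac cx) (le_trans xe eb).
rewrite integral_cst//= lebesgue_measure_itv/= lte_fin.
case: ltP => [_|ec]; first by rewrite -EFinD -EFinM mulrC.
by rewrite mule0 (@le_anti _ _ e c) ?ec ?ce// subrr mul0r.
Qed.

Lemma uniform_on_itv_gt0 X (b c : R) : uniform_on X 0 b ->
  0 <= c -> c < b -> (0 < P (X @^-1` `[c, b]))%E.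
Proof.
move=> uX c0 cb; rewrite (uniform_on_itv uX)// ?(ltW cb)//.
by rewrite lte_fin divr_gt0 ?subr_gt0 ?(le_lt_trans c0 cb).
Qed.

(** When [Y] is bounded by [c], the event that [X] lies in [[c, b]] forces
    [Y <= X]. *)
Lemma prob_le_uniform_eq1 X Y (b c : R) : uniform_on X 0 b ->
  0 <= c -> c < b -> (forall s, Y s <= c) ->
  independent_events P [set s | Y s <= X s] (X @^-1` `[c, b]) ->
  P [set s | Y s <= X s] = 1%E.
Proof.
move=> uX c0 cb Yc iAB; apply: (independent_sub_eq1 _ _ iAB).
- by rewrite -[X in measurable X]setTI; exact: measurable_fun_le.
- exact: measurable_preimage_itv.
- move=> s /=; rewrite in_itv/= => /andP[cX _]; exact: le_trans (Yc s) cX.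
- exact: uniform_on_itv_gt0.
Qed.

(** When [X] is bounded by [c], having both [Y <= X] and [Y] in [[c, b]] pins
    [Y] to the single point [c], which the uniform law does not charge. *)
Lemma prob_le_uniform_eq0 X Y (b c : R) : uniform_on Y 0 b ->
  0 <= c -> c < b -> (forall s, X s <= c) ->
  independent_events P [set s | Y s <= X s] (Y @^-1` `[c, b]) ->
  P [set s | Y s <= X s] = 0%E.
Proof.
move=> uY c0 cb Xc iAB; apply: (independent_setI_eq0 iAB); last first.
  exact: uniform_on_itv_gt0.
(* a degenerate interval stands for the singleton, so that its probability is
   an instance of [uniform_on_itv] *)
apply: (@subset_measure0 _ _ _ P _ (Y @^-1` `[c, c])).
- apply: measurableI; last exact: measurable_preimage_itv.
  by rewrite -[X in measurable X]setTI; exact: measurable_fun_le.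
- exact: measurable_preimage_itv.
- move=> s /= [YX]; rewrite !in_itv/= => /andP[-> _].
  exact: le_trans YX (Xc s).
- by have := uniform_on_itv uY c0 (lexx c) (ltW cb); rewrite subrr mul0r.
Qed.

End UniformErrors.

(** Dividing [Cm * h ^+ m < Ck * h ^+ k] by [Cm * h ^+ k] compares
    [h ^+ (m - k)] with [Ck / Cm], which is [hstar ^+ (m - k)]; the next two
    lemmas then follow from monotonicity of the power. *)
Section Crossover.
Context (R : realType) (Ck Cm h : R) (k m : nat).
Hypotheses (Ck0 : 0 < Ck) (Cm0 : 0 < Cm) (h0 : 0 < h) (km : (k < m)%N).

Let hstar : R := (Ck / Cm) `^ ((m - k)%N%:R^-1).

Let hstar_exp : hstar ^+ (m - k) = Ck / Cm.
Proof.
rewrite -powR_mulrn ?powR_ge0// -powRrM mulVf ?powRr1//.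
- by rewrite divr_ge0 ?ltW.
- by rewrite pnatr_eq0 -lt0n subn_gt0.
Qed.

Lemma ltr_crossover : (Cm * h ^+ m < Ck * h ^+ k) = (h < hstar).
Proof.
rewrite -(subnK (ltnW km)) exprD mulrA ltr_pM2r ?exprn_gt0//.
rewrite mulrC -ltr_pdivlMr// -hstar_exp.
by rewrite ltr_pXn2r ?subn_gt0// nnegrE ?powR_ge0// ltW.
Qed.

Lemma gtr_crossover : (Ck * h ^+ k < Cm * h ^+ m) = (hstar < h).
Proof.
rewrite -(subnK (ltnW km)) exprD mulrA ltr_pM2r ?exprn_gt0//.
rewrite [ltRHS]mulrC -ltr_pdivrMr// -hstar_exp.
by rewrite ltr_pXn2r ?subn_gt0// nnegrE ?powR_ge0// ltW.
Qed.

End Crossover.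

Unset Implicit Arguments.

Theorem corollary3p2 (R : realType) (n : nat) (hn : (0 < n)%N)
  (Omega : set 'rV[R]_n) (hopen : open Omega) (hbounded : bounded_set Omega)
  (hnonempty : Omega !=set0) (hboundary : piecewise_C1_boundary Omega)
  (V : set ('rV[R]_n -> R)) (hV : usual_sobolev_space Omega V)
  (a : ('rV[R]_n -> R) -> ('rV[R]_n -> R) -> R) (ha : elliptic_form Omega V a)
  (l : ('rV[R]_n -> R) -> R) (hl : continuous_linear_form Omega V l)
  (k m : nat) (hk : (0 < k)%N) (hkm : (k < m)%N)
  (u : 'rV[R]_n -> R) (hu : variational_solution a l V u)
  (hureg : sobolev m.+1 Omega u)
  (* the constants of the Bramble-Hilbert estimates *)
  (ck cm : R) (hck : 0 < ck) (hcm : 0 < cm)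
  (Ck Cm : R) (hCk : Ck = ck * sobolev_seminorm k.+1 Omega u)
  (hCm : Cm = cm * sobolev_seminorm m.+1 Omega u)
  (hCk0 : 0 < Ck) (hCm0 : 0 < Cm)
  (sigma h : R) (hh : 0 < h)
  (* the random meshes and the associated approximations *)
  (d : measure_display) (S : measurableType d) (P : probability S R)
  (Tk Tm : S -> seq 'M[R]_(n.+1, n))
  (hTk : forall s, regular_mesh Omega sigma h (Tk s))
  (hTm : forall s, regular_mesh Omega sigma h (Tm s))
  (uk um : S -> 'rV[R]_n -> R)
  (huk : forall s, variational_solution a l (Lagrange_space Omega V k (Tk s)) (uk s))
  (hum : forall s, variational_solution a l (Lagrange_space Omega V m (Tm s)) (um s))
  (Xk Xm : {RV P >-> R})
  (hXk : forall s, Xk s = H1_norm Omega (uk s - u))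
  (hXm : forall s, Xm s = H1_norm Omega (um s - u))
  (hXk_bound : forall s, 0 <= Xk s <= Ck * h ^+ k)
  (hXm_bound : forall s, 0 <= Xm s <= Cm * h ^+ m)
  (hXk_unif : uniform_on Xk 0 (Ck * h ^+ k))
  (hXm_unif : uniform_on Xm 0 (Cm * h ^+ m))
  (hstar : R) (hhstar : hstar = (Ck / Cm) `^ ((m - k)%N%:R^-1))
  (A B B' : set S)
  (hA : A = [set s | H1_norm Omega (um s - u) <= H1_norm Omega (uk s - u)])
  (hB : B = [set s | H1_norm Omega (uk s - u) \in `[Cm * h ^+ m, Ck * h ^+ k]])
  (hAB : independent_events P A B)
  (* for h > hstar the bounds of the interval defining B are in the wrong
     order and B is empty; the roles of k and m in it are exchanged *)
  (hB' : B' = [set s | H1_norm Omega (um s - u) \in `[Ck * h ^+ k, Cm * h ^+ m]])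
  (hAB' : hstar < h -> independent_events P A B') :
  (h < hstar -> P [set s | Xm s <= Xk s] = 1%E) /\
  (hstar < h -> P [set s | Xm s <= Xk s] = 0%E).
Proof.
have AE : A = [set s | Xm s <= Xk s].
  by rewrite hA; apply/funext => s /=; rewrite hXk hXm.
have BE : B = Xk @^-1` `[Cm * h ^+ m, Ck * h ^+ k].
  by rewrite hB; apply/funext => s /=; rewrite hXk.
have BE' : B' = Xm @^-1` `[Ck * h ^+ k, Cm * h ^+ m].
  by rewrite hB'; apply/funext => s /=; rewrite hXm.
have bk0 : 0 <= Ck * h ^+ k by rewrite mulr_ge0 ?exprn_ge0 ?ltW.
have bm0 : 0 <= Cm * h ^+ m by rewrite mulr_ge0 ?exprn_ge0 ?ltW.
split=> hlt.
- apply: (prob_le_uniform_eq1 hXk_unif bm0).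
  + by rewrite ltr_crossover// -hhstar.
  + by move=> s; case/andP: (hXm_bound s).
  + by rewrite -AE -BE.
- apply: (prob_le_uniform_eq0 hXm_unif bk0).
  + by rewrite gtr_crossover// -hhstar.
  + by move=> s; case/andP: (hXk_bound s).
  + by rewrite -AE -BE'; exact: hAB'.
Qed.
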